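(* Let $n$ be a positive integer and let $K_n\subset\mathbb{R}^n$ be the ice-cream cone $$K_n=\Big\{x\in\mathbb{R}^n \;\Big|\; \sum_{i=1}^{n-1}x_i^2\le x_n^2,\ x_n\ge 0\Big\}.$$ Suppose that $A\in M(K_n)$ is Hurwitz. Then there exists a Lyapunov function $V(x)=x^TPx$ for the system $\dot x(t)=Ax(t)$, where either $P=I_n$ or $$P= I_n+ \begin{bmatrix}\bar b\,\bar b^T&0\\0&1\end{bmatrix}\left(\cosh(\|b\|_2)-1\right)+\begin{bmatrix}0&\bar b\\ \bar b^T&0\end{bmatrix}\sinh(\|b\|_2)$$ for some $b\in\mathbb{R}^{n-1}\setminus\{0\}$, with $\bar b:=b/\|b\|_2$.
   Context: $M(K_n)$ is the set of matrices $A\in\mathbb{R}^{n\times n}$ such that $K_n$ is an invariant set of $\dot x(t)=Ax(t)$, i.e. $x(0)\in K_n$ implies $x(t)=\exp(At)x(0)\in K_n$ for all $t\ge 0$. A matrix is Hurwitz if all its eigenvalues have negative real part. For a symmetric matrix $P$, the function $V(x)=x^TPx$ is a Lyapunov function for $\dot x=Ax$ if $P$ is positive-definite and $PA+A^TP$ is negative-definite. $I_n$ is the $n\times n$ identity matrix, $\|\cdot\|_2$ is the Euclidean norm, and the block matrices are partitioned with a leading block of size $(n-1)\times(n-1)$ and a trailing block of size $1\times 1$. *)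

(* Defs.v *)
From HB Require Import structures.
From mathcomp Require Import all_boot all_order all_algebra.
From mathcomp Require Import all_classical all_reals all_analysis.
From mathcomp Require Import complex.
Import Order.TTheory GRing.Theory Num.Theory numFieldNormedType.Exports.

Set Implicit Arguments.
Unset Strict Implicit.
Unset Printing Implicit Defensive.

Local Open Scope classical_set_scope.
Local Open Scope ring_scope.

Definition coshR (R : realType) (x : R) : R := (expR x + expR (- x)) / 2.

Definition sinhR (R : realType) (x : R) : R := (expR x - expR (- x)) / 2.

(* The norm `|v| that the library puts on matrices is the maximum norm. *)
Definition norm2 (R : realType) (n : nat) (v : 'cV[R]_n) : R :=
  Num.sqrt (\sum_(i < n) v i 0 ^+ 2).

Definition expmx (R : realType) (n : nat) (A : 'M[R]_n) : 'M[R]_n :=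
  limn (series (fun k : nat => (k`!%:R)^-1 *: A ^+ k)).

(* The positive dimension is written m + 1, so that block_mx, usubmx and dsubmx
   split off the last coordinate. *)
Definition icecream (R : realType) (m : nat) : set 'cV[R]_(m + 1) :=
  [set x | \sum_(i < m) usubmx x i 0 ^+ 2 <= dsubmx x 0 0 ^+ 2
           /\ 0 <= dsubmx x 0 0].

Definition flow_invariant (R : realType) (n : nat) (K : set 'cV[R]_n) :
    set 'M[R]_n :=
  [set A | forall x, K x -> forall t : R, 0 <= t -> K (expmx (t *: A) *m x)].

(* [eigenvalue] refers to row eigenvectors; the eigenvalues of a square matrix
   are the same for row and for column eigenvectors. *)
Definition hurwitz (R : realType) (n : nat) (A : 'M[R]_n) : Prop :=
  forall l : R[i], eigenvalue (map_mx (real_complex R) A) l -> complex.Re l < 0.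

Definition posdefmx (R : realType) (n : nat) (P : 'M[R]_n) : Prop :=
  P \is symmetricmx
  /\ forall x : 'cV[R]_n, x != 0 -> 0 < (x^T *m P *m x) 0 0.

Definition negdefmx (R : realType) (n : nat) (P : 'M[R]_n) : Prop :=
  posdefmx (- P).

(* x |-> x^T P x is a Lyapunov function for x' = A x. *)
Definition lyapunov (R : realType) (n : nat) (A P : 'M[R]_n) : Prop :=
  posdefmx P /\ negdefmx (P *m A + A^T *m P).

(* Main.v *)
From HB Require Import structures.
Require Import Defs.
From mathcomp Require Import all_boot all_order all_algebra.
From mathcomp Require Import all_classical all_reals all_analysis.
From mathcomp Require Import complex ring lra.
Import Order.TTheory GRing.Theory Num.Theory numFieldNormedType.Exports.
Local Open Scope classical_set_scope.
Local Open Scope ring_scope.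

(* Write J = diag(-1, ..., -1, 1). Differentiating the invariance of the cone at
   a boundary point shows that A is cross-positive: x^T J A x >= 0 whenever
   x^T J x = 0; the same then holds for A^T. If moreover A is Hurwitz, the
   matrices (1 - s) I - s A, 0 <= s <= 1, are invertible, and following the
   solution of ((1 - s) I - s A) y = e from s = 0 to s = 1 one stays inside the
   cone; so there are v, w in the interior of the cone with - A v and - A^T w in
   the interior. Normalise v^T J v = w^T J w = 1. The boosts 2 a a^T - J with
   a^T J a = 1 are exactly the matrices P of the statement; they preserve J, and
   one of them maps v to w. If P A + A^T P were not negative definite, the
   maximum mu >= 0 of its Rayleigh quotient relative to P would be an eigenvalue
   of the matrix A + P^-1 A^T P, which is again cross-positive and maps v to
   - int K; this is impossible (Perron-Frobenius). *)

Set Implicit Arguments.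
Unset Strict Implicit.
Unset Printing Implicit Defensive.

(** * Euclidean inner product and norm on column vectors *)

Section DotProduct.
Context {R : realType} {n : nat}.
Implicit Types (x y z : 'cV[R]_n) (c : R).

Definition dotv x y : R := (x^T *m y) 0 0.

Lemma dotvE x y : dotv x y = \sum_i x i 0 * y i 0.
Proof. by rewrite /dotv mxE; apply: eq_bigr => i _; rewrite mxE. Qed.

Lemma dotvC x y : dotv x y = dotv y x.
Proof. by rewrite !dotvE; apply: eq_bigr => i _; rewrite mulrC. Qed.

Lemma dotvDr x y z : dotv x (y + z) = dotv x y + dotv x z.
Proof. by rewrite /dotv mulmxDr mxE. Qed.

Lemma dotvZr c x y : dotv x (c *: y) = c * dotv x y.
Proof. by rewrite /dotv -scalemxAr mxE. Qed.

Lemma dotvNr x y : dotv x (- y) = - dotv x y.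
Proof. by rewrite -scaleN1r dotvZr mulN1r. Qed.

Lemma dotvDl x y z : dotv (x + y) z = dotv x z + dotv y z.
Proof. by rewrite dotvC dotvDr !(dotvC z). Qed.

Lemma dotvZl c x y : dotv (c *: x) y = c * dotv x y.
Proof. by rewrite dotvC dotvZr dotvC. Qed.

Lemma dotvNl x y : dotv (- x) y = - dotv x y.
Proof. by rewrite dotvC dotvNr dotvC. Qed.

Lemma dotv_ge0 x : 0 <= dotv x x.
Proof. by rewrite dotvE sumr_ge0 // => i _; rewrite -expr2 sqr_ge0. Qed.

Lemma dotv_eq0 x : (dotv x x == 0) = (x == 0).
Proof.
apply/idP/eqP => [|->]; last by rewrite /dotv mulmx0 mxE.
rewrite dotvE psumr_eq0 => [/allP x0|i _]; last by rewrite -expr2 sqr_ge0.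
apply/colP => i; rewrite mxE; apply/eqP.
by have := x0 i (mem_index_enum i); rewrite mulf_eq0 orbb.
Qed.

Lemma dotv_gt0 x : x != 0 -> 0 < dotv x x.
Proof. by move=> x0; rewrite lt_def dotv_eq0 x0 dotv_ge0. Qed.

Lemma norm2_ge0 x : 0 <= norm2 x.
Proof. exact: sqrtr_ge0. Qed.

Lemma norm2E x : norm2 x = Num.sqrt (dotv x x).
Proof.
by rewrite dotvE; congr Num.sqrt; apply: eq_bigr => i _; rewrite expr2.
Qed.

Lemma norm2_sqr x : norm2 x ^+ 2 = dotv x x.
Proof. by rewrite norm2E sqr_sqrtr ?dotv_ge0. Qed.

Lemma norm2_eq0 x : (norm2 x == 0) = (x == 0).
Proof. by rewrite -dotv_eq0 -norm2_sqr sqrf_eq0. Qed.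

Lemma norm2Z c x : norm2 (c *: x) = `|c| * norm2 x.
Proof.
by rewrite !norm2E dotvZl dotvZr mulrA -expr2 sqrtrM ?sqr_ge0// sqrtr_sqr.
Qed.

Lemma norm2N x : norm2 (- x) = norm2 x.
Proof. by rewrite -scaleN1r norm2Z normrN1 mul1r. Qed.

Lemma norm_entry_le_norm2 x i : `|x i 0| <= norm2 x.
Proof.
rewrite -(@ler_pXn2r _ 2) ?nnegrE ?norm2_ge0// norm2_sqr dotvE real_normK ?num_real//.
rewrite (bigD1 i)//= -expr2 lerDl sumr_ge0 // => j _; rewrite -expr2 sqr_ge0 //.
Qed.

Lemma dotv_sqr_le x y : dotv x y ^+ 2 <= dotv x x * dotv y y.
Proof.
have [->|/dotv_gt0 yy0] := eqVneq y 0.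
  by rewrite /dotv !mulmx0 mxE expr0n/= mulr0.
(* This is the component of [x] orthogonal to [y], scaled by [dotv y y] to avoid a division; its
   square is [dotv y y] times the desired gap. *)
have := dotv_ge0 (dotv y y *: x - dotv x y *: y).
rewrite !(dotvDl, dotvDr, dotvNl, dotvNr, dotvZl, dotvZr) (dotvC y x) => H.
rewrite -(ler_pM2l yy0) -subr_ge0.
by apply: le_trans H _; rewrite le_eqVlt; apply/orP; left; apply/eqP; ring.
Qed.

Lemma cauchy_schwarz x y : `|dotv x y| <= norm2 x * norm2 y.
Proof.
rewrite -(@ler_pXn2r _ 2) ?nnegrE ?mulr_ge0 ?norm2_ge0//.
by rewrite exprMn !norm2_sqr real_normK ?num_real// dotv_sqr_le.
Qed.

End DotProduct.

Lemma dotv_mulmx (R : realType) (n p : nat) (M : 'M[R]_(n, p)) x y :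
  dotv x (M *m y) = dotv (M^T *m x) y.
Proof. by rewrite /dotv trmx_mul trmxK mulmxA. Qed.

Lemma quad_dotv (R : realType) (n : nat) (P : 'M[R]_n) (x : 'cV[R]_n) :
  (x^T *m P *m x) 0 0 = dotv x (P *m x).
Proof. by rewrite /dotv mulmxA. Qed.

Lemma symmetricmxE (R : realType) (n : nat) (P : 'M[R]_n) :
  (P \is symmetricmx) = (P^T == P).
Proof. by rewrite qualifE/= expr0 scale1r map_mx_id// eq_sym. Qed.

(** * The Lorentz form and the interior of the cone *)

Section LorentzForm.
Context {R : realType} {m : nat}.
Implicit Types (x y z u v w : 'cV[R]_(m + 1)) (c : R) (A P : 'M[R]_(m + 1)).

Definition lastc x : R := dsubmx x 0 0.

Definition minkowski : 'M[R]_(m + 1) := block_mx (- 1%:M) 0 0 1%:M.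

Notation J := minkowski.

Definition lor x y : R := dotv x (J *m y).

(** The norm being nonnegative, the strict inequality already forces a positive last coordinate. *)
Definition icone_int x : Prop := norm2 (usubmx x) < lastc x.

Lemma dotv_split x y :
  dotv x y = dotv (usubmx x) (usubmx y) + lastc x * lastc y.
Proof.
rewrite /dotv -{1}(vsubmxK x) -{1}(vsubmxK y) tr_col_mx mul_row_col mxE.
by congr (_ + _); rewrite mxE big_ord1 mxE.
Qed.

Lemma minkowski_mul x : J *m x = col_mx (- usubmx x) (dsubmx x).
Proof.
rewrite -{1}(vsubmxK x) /J mul_block_col !mul0mx mul1mx mulNmx mul1mx.
by rewrite addr0 add0r.
Qed.

Lemma tr_minkowski : J^T = J.
Proof.
by rewrite /J tr_block_mx !linear0 linearN/= !tr_scalar_mx.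
Qed.

Lemma minkowskiK : J *m J = 1%:M.
Proof.
rewrite /J mulmx_block !mul0mx !mulmx0 !addr0 !add0r mul1mx mulNmx mul1mx opprK.
by rewrite -scalar_mx_block.
Qed.

Lemma usub_minkowski x : usubmx (J *m x) = - usubmx x.
Proof. by rewrite minkowski_mul col_mxKu. Qed.

Lemma lastc_minkowski x : lastc (J *m x) = lastc x.
Proof. by rewrite /lastc minkowski_mul col_mxKd. Qed.

Lemma lorE x y : lor x y = lastc x * lastc y - dotv (usubmx x) (usubmx y).
Proof.
by rewrite /lor dotv_split usub_minkowski lastc_minkowski dotvNr addrC.
Qed.

Lemma lor_sqr x : lor x x = lastc x ^+ 2 - norm2 (usubmx x) ^+ 2.
Proof. by rewrite lorE norm2_sqr expr2. Qed.

Lemma lorC x y : lor x y = lor y x.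
Proof. by rewrite !lorE mulrC dotvC. Qed.

Lemma lorDr x y z : lor x (y + z) = lor x y + lor x z.
Proof. by rewrite /lor mulmxDr dotvDr. Qed.

Lemma lorZr c x y : lor x (c *: y) = c * lor x y.
Proof. by rewrite /lor -scalemxAr dotvZr. Qed.

Lemma lorNr x y : lor x (- y) = - lor x y.
Proof. by rewrite /lor mulmxN dotvNr. Qed.

Lemma lorDl x y z : lor (x + y) z = lor x z + lor y z.
Proof. by rewrite /lor dotvDl. Qed.

Lemma lorZl c x y : lor (c *: x) y = c * lor x y.
Proof. by rewrite /lor dotvZl. Qed.

Lemma lorNl x y : lor (- x) y = - lor x y.
Proof. by rewrite /lor dotvNl. Qed.

Lemma lor_minkowski x y : lor x (J *m y) = dotv x y.
Proof. by rewrite /lor mulmxA minkowskiK mul1mx. Qed.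

Lemma lor_minkowskil x y : lor (J *m x) y = dotv x y.
Proof. by rewrite lorC lor_minkowski dotvC. Qed.

Lemma lastcD x y : lastc (x + y) = lastc x + lastc y.
Proof. by rewrite /lastc linearD mxE. Qed.

Lemma lastcZ c x : lastc (c *: x) = c * lastc x.
Proof. by rewrite /lastc linearZ/= mxE. Qed.

Lemma lastcN x : lastc (- x) = - lastc x.
Proof. by rewrite /lastc linearN mxE. Qed.

Lemma col_eq0 x : usubmx x = 0 -> lastc x = 0 -> x = 0.
Proof.
move=> ux lx; rewrite -(vsubmxK x) ux.
have -> : dsubmx x = 0 by apply/matrixP => i j; rewrite !ord1 [RHS]mxE.
by rewrite col_mx0.
Qed.

Lemma icone_int_lastc_gt0 x : icone_int x -> 0 < lastc x.
Proof. exact/le_lt_trans/norm2_ge0. Qed.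

Lemma icone_intP x : icone_int x <-> 0 < lastc x /\ 0 < lor x x.
Proof.
rewrite /icone_int lor_sqr subr_gt0; split=> [xK|[x0]].
  have x0 := icone_int_lastc_gt0 xK; split=> //.
  by rewrite ltr_pXn2r ?nnegrE ?norm2_ge0// ltW.
by rewrite ltr_pXn2r ?nnegrE ?norm2_ge0// ltW.
Qed.

Lemma icone_intZ c x : 0 < c -> icone_int x -> icone_int (c *: x).
Proof.
move=> c0; rewrite /icone_int linearZ/= norm2Z lastcZ gtr0_norm//.
by rewrite ltr_pM2l.
Qed.

Lemma icone_int_minkowski x : icone_int x -> icone_int (J *m x).
Proof. by rewrite /icone_int usub_minkowski norm2N lastc_minkowski. Qed.

(** Self-duality of the cone: Cauchy-Schwarz bounds the inner product of the leading blocks, and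
    strictness comes from [y]. *)
Lemma lor_cone_int_gt0 x y :
  norm2 (usubmx x) <= lastc x -> 0 < lastc x -> icone_int y -> 0 < lor x y.
Proof.
move=> xK x0 yK; rewrite lorE subr_gt0.
apply: le_lt_trans (ler_norm _) _; apply: le_lt_trans (cauchy_schwarz _ _) _.
apply: le_lt_trans (_ : lastc x * norm2 (usubmx y) < _).
  by rewrite ler_wpM2r ?norm2_ge0.
by rewrite ltr_pM2l.
Qed.

Lemma lor_int_gt0 x y : icone_int x -> icone_int y -> 0 < lor x y.
Proof.
by move=> xK; apply: lor_cone_int_gt0 (ltW xK) (icone_int_lastc_gt0 xK).
Qed.

Lemma dotv_int_gt0 x y : icone_int x -> icone_int y -> 0 < dotv x y.
Proof.
by move=> xK yK; rewrite -lor_minkowski lor_int_gt0//; apply: icone_int_minkowski.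
Qed.

Lemma icone_intD x y : icone_int x -> icone_int y -> icone_int (x + y).
Proof.
move=> xK yK; apply/icone_intP; split.
  by rewrite lastcD addr_gt0 ?icone_int_lastc_gt0.
by rewrite lorDl !lorDr !addr_gt0 ?lor_int_gt0.
Qed.

(* On the boundary of the cone the only supporting functional at x is, up to
   a positive factor, the vector J x; the condition is therefore the usual
   cross-positivity of A. *)
Definition cross_positive A : Prop :=
  forall x, lor x x = 0 -> 0 <= lor x (A *m x).

(** [J] preserves the null vectors of the form, so the hypothesis can be applied at [J x]; moving
    [A] across the inner product gives the claim at [x]. *)
Lemma cross_positive_tr A : cross_positive A -> cross_positive A^T.
Proof.
move=> cpA x x0; have := cpA (J *m x).
rewrite lor_minkowskil -/(lor x x) => /(_ x0).
by rewrite lor_minkowskil dotv_mulmx -/(lor _ _) lorC.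
Qed.

End LorentzForm.
Arguments minkowski {R m}.
Notation J := minkowski.

(** * Lorentz boosts *)

Section QuadraticRepresentation.
Context {R : realType} {m : nat}.
Implicit Types (a x y z u v w : 'cV[R]_(m + 1)).

(* The quadratic representation of the spin factor, at a point a with
   lor a a = 1: these are the Lorentz boosts. *)
Definition boost a : 'M[R]_(m + 1) := 2 *: (a *m a^T) - J.

Lemma boost_mul a x : boost a *m x = (2 * dotv a x) *: a - J *m x.
Proof.
rewrite /boost mulmxBl -scalemxAl -mulmxA; congr (_ - _).
by rewrite [a^T *m x]mx11_scalar mul_mx_scalar scalerA.
Qed.

Lemma tr_boost a : (boost a)^T = boost a.
Proof. by rewrite /boost linearB/= linearZ/= trmx_mul trmxK tr_minkowski. Qed.

(** The coefficients of [a] cancel because [lor a a = 1]. In matrix form [P J P = J], so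
    [P = boost a] has inverse [J P J]. *)
Lemma boostK a x : lor a a = 1 -> boost a *m (J *m (boost a *m x)) = J *m x.
Proof.
move=> a1; rewrite (boost_mul a x) mulmxBr -scalemxAr mulmxA minkowskiK mul1mx.
rewrite boost_mul mulmxBr -scalemxAr mulmxA minkowskiK mul1mx.
rewrite dotvDr dotvNr dotvZr -/(lor a a) a1 mulr1 opprB addrCA -scalerBl.
set d := dotv a x; rewrite (_ : 2 * (2 * d - d) - 2 * d = 0); last by ring.
by rewrite scale0r addr0.
Qed.

Lemma lor_boost a x y : lor a a = 1 ->
  lor (boost a *m x) (boost a *m y) = lor x y.
Proof.
by move=> a1; rewrite /lor -{1}(tr_boost a) -dotv_mulmx boostK.
Qed.

Lemma icone_int_boost a x : lor a a = 1 -> icone_int a -> icone_int x ->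
  icone_int (boost a *m x).
Proof.
move=> a1 aK xK; have [x0 xx0] := (icone_intP x).1 xK.
apply/icone_intP; rewrite lor_boost//; split=> //.
rewrite boost_mul lastcD lastcN lastc_minkowski lastcZ.
have [a0 _] := (icone_intP a).1 aK.
have := a1; rewrite lor_sqr => aE.
have := xK; rewrite /icone_int => xlt.
rewrite dotv_split.
have := cauchy_schwarz (usubmx a) (usubmx x); rewrite ler_norml => /andP[+ _].
have := norm2_ge0 (usubmx a); have := norm2_ge0 (usubmx x).
move: (dotv _ _) (norm2 (usubmx x)) (norm2 (usubmx a)) (lastc a) (lastc x) aE x0 xlt a0
  => d nx na la lx aE x0 xlt a0 nx0 na0 dge.
(* Modulo [aE], the last coordinate is twice the quantity of [h1], plus twice that of [h2], plus
   that of [h3]. *)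
have h1 : 0 <= la * (d + na * nx) by rewrite mulr_ge0 ?(ltW a0)//; lra.
have h2 : 0 <= (la * na) * (lx - nx) by rewrite !mulr_ge0 ?(ltW a0)//; lra.
have h3 : 0 < lx * (la - na) ^+ 2.
  rewrite mulr_gt0// lt_def sqr_ge0 sqrf_eq0 subr_eq0 andbT.
  by apply/eqP => lana; move/eqP: aE; rewrite lana subrr eq_sym oner_eq0.
nra.
Qed.

Lemma boost_posdef a : lor a a = 1 -> posdefmx (boost a).
Proof.
move=> a1; split; first by rewrite symmetricmxE tr_boost.
move=> x x0; rewrite quad_dotv boost_mul dotvDr dotvNr dotvZr -/(lor x x) lorE.
rewrite (dotvC x a) dotv_split.
have := a1; rewrite lorE.
have := dotv_sqr_le (usubmx a) (usubmx x).
have := dotv_ge0 (usubmx a); have := dotv_ge0 (usubmx x).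
have : (0 < dotv (usubmx x) (usubmx x)) || (lastc x != 0) && (usubmx x == 0).
  have [ux|ux] := eqVneq (usubmx x) 0; last by rewrite dotv_gt0.
  apply/orP; right; rewrite andbT; apply: contraNneq x0 => lx.
  by rewrite (col_eq0 ux lx).
move: (dotv (usubmx x) (usubmx x)) (dotv (usubmx a) (usubmx a))
  (dotv (usubmx a) (usubmx x)) (lastc a) (lastc x)
  => X N s al xi pos X0 N0 CS a1'.
have NE : N = al ^+ 2 - 1 by lra.
(* By [NE], [2 * N + 1] is the coefficient of [xi ^+ 2]; multiplying by it completes the square, and
   what remains is [X] plus a Cauchy-Schwarz gap. *)
rewrite -(pmulr_rgt0 _ (_ : 0 < 2 * N + 1)); last by lra.
rewrite (_ : (2 * N + 1) * _ = ((2 * N + 1) * xi + 2 * al * s) ^+ 2 + X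
                       + 2 * (N * X - s ^+ 2)); last by rewrite NE; ring.
have CS' : 0 <= 2 * (N * X - s ^+ 2) by rewrite mulr_ge0// subr_ge0.
have [Xgt0|Xle0] := ltP 0 X.
  by have := sqr_ge0 ((2 * N + 1) * xi + 2 * al * s); lra.
have X_0 : X = 0 by lra.
move: pos; rewrite X_0 ltxx orFb => /andP[xi0 _].
have s_0 : s = 0.
  apply/eqP; rewrite -sqrf_eq0 eq_le sqr_ge0 andbT.
  by move: CS; rewrite X_0 mulr0.
rewrite s_0 !mulr0 expr0n/= subrr mulr0 !addr0 lt_def sqr_ge0 andbT.
by rewrite sqrf_eq0 mulf_neq0// gt_eqF//; lra.
Qed.

(** As [l ^+ 2 - N ^+ 2 = 1], one can write [l = cosh (beta / 2)] and [N = sinh (beta / 2)], that is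
    [l + N = exp (beta / 2)]. The double-argument formulas [cosh beta - 1 = 2 N^2] and
    [sinh beta = 2 l N] then match the blocks; [N = 0] gives the identity. *)
Lemma boostE a : lor a a = 1 -> 0 < lastc a ->
  boost a = 1%:M \/
     exists b : 'cV[R]_m, b != 0 /\
       let bbar : 'cV[R]_m := (norm2 b)^-1 *: b in
       boost a = 1%:M
           + (coshR (norm2 b) - 1) *:
               block_mx (bbar *m bbar^T) 0 0 (1%:M : 'M[R]_1)
           + sinhR (norm2 b) *:
               block_mx (0 : 'M[R]_m) bbar bbar^T (0 : 'M[R]_1).
Proof.
move=> + a0; rewrite lor_sqr.
set l := lastc a in a0 *; set N := norm2 (usubmx a) => a1.
have blockE : boost a = block_mx (2 *: (usubmx a *m (usubmx a)^T) + 1%:M)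
   ((2 * l) *: usubmx a) ((2 * l) *: (usubmx a)^T) (2 * l ^+ 2 - 1)%:M.
  have aE : a = col_mx (usubmx a) l%:M.
    by rewrite -[LHS]vsubmxK [dsubmx a]mx11_scalar.
  rewrite /boost {1 2}aE tr_col_mx mul_col_row scale_block_mx opp_block_mx.
  rewrite add_block_mx opprK !oppr0 !addr0 tr_scalar_mx mul_mx_scalar.
  rewrite mul_scalar_mx !scalerA; congr block_mx.
  by rewrite -scalar_mxM scale_scalar_mx -raddfB/= expr2.
have [N0|N0] := eqVneq N 0.
  left; have := N0; move/eqP; rewrite norm2_eq0 => /eqP u0.
  have l1 : l ^+ 2 = 1 by rewrite -a1 N0 expr0n subr0.
  rewrite blockE u0 trmx0 mulmx0 !scaler0 add0r l1 mulr1.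
  by rewrite (_ : 2 - 1 = 1 :> R) -?scalar_mx_block//; ring.
right.
have Ngt0 : 0 < N by rewrite lt_def N0 norm2_ge0.
pose beta := ln ((l + N) ^+ 2).
have lN : 0 < l + N by rewrite addr_gt0.
have lN1 : 1 < (l + N) ^+ 2 by nra.
have beta0 : 0 < beta by rewrite ln_gt0.
have expb : expR beta = (l + N) ^+ 2 by rewrite lnK// posrE; nra.
have expNb : expR (- beta) = (l - N) ^+ 2.
  rewrite expRN expb; apply: (mulfI (x := (l + N) ^+ 2)); first by rewrite gt_eqF ?exprn_gt0.
  by rewrite mulfV ?gt_eqF ?exprn_gt0// -exprMn mulrC -subr_sqr a1 expr1n.
pose b := (beta / N) *: usubmx a.
have normb : norm2 b = beta.
  by rewrite norm2Z gtr0_norm ?divr_gt0// -/N divfK.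
exists b; split; first by rewrite -norm2_eq0 normb gt_eqF.
rewrite /= normb.
have -> : beta^-1 *: b = N^-1 *: usubmx a.
  by rewrite scalerA mulrA mulVf ?gt_eqF// mul1r.
have -> : coshR beta - 1 = 2 * N ^+ 2.
  by rewrite /coshR expb expNb; nra.
have -> : sinhR beta = 2 * l * N.
  by rewrite /sinhR expb expNb; field.
rewrite blockE !scale_block_mx scalar_mx_block !add_block_mx !scaler0 !addr0 !add0r.
congr block_mx.
- rewrite addrC linearZ/= -scalemxAl -scalemxAr !scalerA; congr (_ + _ *: _).
  by field.
- by rewrite scalerA; congr (_ *: _); field.
- by rewrite linearZ/= scalerA; congr (_ *: _); field.
- by rewrite scale_scalar_mx mulr1 -raddfD; congr (_%:M); nra.
Qed.

(* As boost a *m v = 2 <a, v> a - J v, the vector a has to be proportional to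
   w + J v. *)
Lemma boost_transitive v w : icone_int v -> icone_int w ->
  lor v v = 1 -> lor w w = 1 ->
  exists a, [/\ icone_int a, lor a a = 1 & boost a *m v = w].
Proof.
move=> vK wK v1 w1.
have vw := dotv_int_gt0 vK wK.
(* [k] is the Lorentz length of [w + J v], see [ss] below. *)
pose k := Num.sqrt (2 * (1 + dotv v w)).
have k2 : k ^+ 2 = 2 * (1 + dotv v w) by rewrite sqr_sqrtr//; lra.
have k0 : 0 < k by rewrite sqrtr_gt0; lra.
pose s := w + J *m v.
have sK : icone_int s by apply: icone_intD => //; exact: icone_int_minkowski.
have ss : lor s s = k ^+ 2.
  rewrite k2 /s lorDl !lorDr w1 !lor_minkowskil lor_minkowski -/(lor v v) v1.
  by rewrite (dotvC w v); ring.
have sv : 2 * dotv s v = k ^+ 2.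
  by rewrite k2 /s dotvDl dotvC (dotvC (J *m v)) -/(lor v v) v1 addrC.
exists (k^-1 *: s); split; first by apply: icone_intZ; rewrite ?invr_gt0.
  by rewrite lorZl lorZr ss; field; rewrite gt_eqF.
rewrite boost_mul dotvZl scalerA (_ : 2 * (k^-1 * dotv s v) * k^-1 = 1).
  by rewrite scale1r /s addrK.
have -> : dotv s v = k ^+ 2 / 2 by rewrite -sv; field.
by field; rewrite gt_eqF.
Qed.

End QuadraticRepresentation.

(** * Boundary of the cone and cross-positive matrices *)

Lemma cvg_sumr (R : realType) (T I : Type) (F : set_system T) (r : seq I)
    (f : I -> T -> R) (l : I -> R) : Filter F ->
  (forall i, f i x @[x --> F] --> l i) ->
  \sum_(i <- r) f i x @[x --> F] --> \sum_(i <- r) l i.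
Proof. by move=> FF fl; apply: cvg_big => //; exact: add_continuous. Qed.

Section ConeBoundary.
Context {R : realType} {m : nat}.
Implicit Types (x y u v : 'cV[R]_(m + 1)) (A : 'M[R]_(m + 1)).

Lemma cone_boundary_lor x : norm2 (usubmx x) = lastc x -> lor x x = 0.
Proof. by move=> xb; rewrite lor_sqr xb subrr. Qed.

Lemma cone_boundary_lor_int_gt0 x u :
  norm2 (usubmx x) = lastc x -> x != 0 -> icone_int u -> 0 < lor x u.
Proof.
move=> xb x0 uK; apply: lor_cone_int_gt0 uK; first by rewrite xb.
rewrite -xb lt_def norm2_ge0 andbT norm2_eq0; apply: contraNneq x0 => ux.
by rewrite (col_eq0 ux)// -xb ux; apply/eqP; rewrite norm2_eq0.
Qed.

(** Intermediate value theorem for the gap [lastc - norm2], which is positive exactly on the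
    interior. *)
Lemma path_meets_boundary (f : R -> 'cV[R]_(m + 1)) :
  (forall i, continuous (fun t => f t i 0)) ->
  icone_int (f 0) -> ~ icone_int (f 1) ->
  exists2 t, 0 <= t <= 1 & norm2 (usubmx (f t)) = lastc (f t).
Proof.
move=> fc f0 /negP; rewrite -leNgt => f1.
pose g t := lastc (f t) - norm2 (usubmx (f t)).
have gc : continuous g.
  move=> t; apply: cvgB.
    have lE x : lastc x = x (rshift m 0) 0 by rewrite /lastc mxE.
    by under eq_fun do rewrite lE; rewrite lE; exact: fc.
  apply: (@continuous_comp _ _ _ (fun t => \sum_i (usubmx (f t)) i 0 ^+ 2)).
    apply: cvg_sumr => i.
    have uE x : usubmx x i 0 = x (lshift 1 i) 0 by rewrite mxE.
    by under eq_fun do rewrite uE expr2; rewrite uE expr2; apply: cvgM; exact: fc.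
  exact: sqrt_continuous.
have g0 : 0 < g 0 by rewrite subr_gt0.
have g1 : g 1 <= 0 by rewrite subr_le0.
have [||t] := @IVT R g 0 1 0 ler01; first exact: continuous_subspaceT.
  by rewrite ge_min le_max g1 (ltW g0) orbT.
rewrite in_itv/= => t01 /eqP; rewrite subr_eq0 => /eqP gt.
by exists t.
Qed.

(* The segment from v along the eigenvector leaves the cone at a point y where
   cross-positivity is violated. *)
Lemma cross_positive_no_eigen A v x (mu : R) :
  cross_positive A -> icone_int v -> icone_int (- (A *m v)) ->
  0 <= mu -> A *m x = mu *: x -> x = 0.
Proof.
move=> cpA vK AvK mu0 Ax; apply/eqP; apply: contraT => x0.
(* The line through [v] along [x] leaves the cone: if [lastc x = 0], make one leading coordinate
   equal to [lastc v]; otherwise make the last coordinate vanish. *)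
have [t tout] : exists t, ~ icone_int (v - t *: x).
  have [lx|lx] := eqVneq (lastc x) 0.
    have ux : usubmx x != 0.
      by apply: contraNneq x0 => ux; rewrite (col_eq0 ux lx).
    have [i xi] : exists i, usubmx x i 0 != 0.
      apply/existsP; apply: contraT; rewrite negb_exists => /forallP ux0.
      case/eqP: ux; apply/colP => i; rewrite [RHS]mxE.
      by have := ux0 i; rewrite negbK => /eqP.
    exists ((usubmx v i 0 - lastc v) / usubmx x i 0).
    rewrite /icone_int lastcD lastcN lastcZ lx mulr0 subr0; apply/negP.
    rewrite -leNgt; apply: le_trans (norm_entry_le_norm2 _ i).
    rewrite linearB/= linearZ/= [X in `|X|]mxE [X in _ + X]mxE [X in _ - X]mxE.
    by rewrite divfK// opprB addrC subrK ler_norm.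
  exists (lastc v / lastc x); apply/negP; rewrite -leNgt.
  by rewrite lastcD lastcN lastcZ divfK// subrr norm2_ge0.
have [||//|s s01] := @path_meets_boundary (fun s => v - (s * t) *: x).
- move=> i s.
  rewrite (_ : (fun s => _) = (fun s => v i 0 - (s * t) * x i 0)); last first.
    by apply/funext => r; rewrite !mxE.
  apply: cvgB; first exact: cvg_cst.
  by apply: cvgMr_tmp; apply: cvgMr_tmp; exact: cvg_id.
- by rewrite mul0r scale0r subr0.
- by rewrite mul1r.
set y := v - _ *: x => yb.
have Ay : A *m y = A *m v + mu *: (y - v).
  rewrite mulmxBr -scalemxAr Ax /y addrAC subrr add0r scalerN; congr (_ - _).
  by rewrite !scalerA mulrC.
(* If [y = 0], then [v] is a multiple of [x], so [A v = mu v] and [- A v] has a nonpositive last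
   coordinate. *)
have y0 : y != 0.
  apply/eqP => y0; have : v - y = (s * t) *: x by rewrite /y opprB addrC subrK.
  rewrite y0 subr0 => vE.
  have := icone_int_lastc_gt0 AvK; rewrite lastcN vE -scalemxAr Ax.
  rewrite scalerA mulrC -scalerA -vE lastcZ oppr_gt0 ltNge mulr_ge0//.
  exact/ltW/icone_int_lastc_gt0.
have yy := cone_boundary_lor yb.
have := cpA y yy; rewrite Ay lorDr lorZr lorDr lorNr yy add0r.
have := cone_boundary_lor_int_gt0 yb y0 AvK; rewrite lorNr => yAv.
have := mulr_ge0 mu0 (ltW (cone_boundary_lor_int_gt0 yb y0 vK)).
lra.
Qed.

(* Homotopy from I to - A. The extra factor \det in Yp makes the right-hand side
   \det ^ 2 *: e of the equation for Y nonnegative. *)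
Lemma cross_positive_int_vector A :
  cross_positive A ->
  (forall s, 0 <= s <= 1 -> \det ((1 - s)%:M - s *: A) != 0) ->
  exists v, icone_int v /\ icone_int (- (A *m v)).
Proof.
move=> cpA detA.
pose e : 'cV[R]_(m + 1) := col_mx 0 1%:M.
have eu : usubmx e = 0 by rewrite col_mxKu.
have el : lastc e = 1 by rewrite /lastc col_mxKd mxE.
have eK : icone_int e.
  by rewrite /icone_int eu el (eqP (_ : norm2 0 == 0)) ?norm2_eq0.
(* Working over polynomials in [s] makes the adjugate solution polynomial, hence continuous. *)
pose Bp : 'M[{poly R}]_(m + 1) := (1 - 'X)%:M - 'X *: map_mx polyC A.
pose B s := (1 - s)%:M - s *: A.
have BE s : map_mx (horner_eval s) Bp = B s.
  apply/matrixP => i j; rewrite !mxE /horner_eval !hornerE.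
  by case: (i == j); rewrite ?mulr1n ?mulr0n !hornerE.
pose Yp : 'cV[{poly R}]_(m + 1) := \det Bp *: (\adj Bp *m map_mx polyC e).
pose Y s := map_mx (horner_eval s) Yp.
have BY s : B s *m Y s = (\det (B s) ^+ 2) *: e.
  rewrite -BE -map_mxM -scalemxAr mulmxA mul_mx_adj mul_scalar_mx scalerA -expr2.
  rewrite map_mxZ rmorphXn/= -det_map_mx -map_mx_comp map_mx_id// => c /=.
  by rewrite /horner_eval hornerC.
have Y1 : icone_int (Y 1).
  apply: contrapT => nY1.
  have Y0 : icone_int (Y 0).
    have := BY 0; rewrite /B subr0 scale0r subr0 mul1mx det1 expr1n scale1r.
    by move=> ->.
  have Yc i : continuous (fun s => Y s i 0).
    rewrite (_ : (fun s => _) = horner (Yp i 0)); first exact: continuous_horner.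
    by apply/funext => s; rewrite mxE.
  have [s s01 Yb] := path_meets_boundary Yc Y0 nY1.
  have d0 : 0 < \det (B s) ^+ 2 by rewrite lt_def sqr_ge0 sqrf_eq0 detA.
  have Ys0 : Y s != 0.
    apply/eqP => Ys; have := BY s; rewrite Ys mulmx0 => /(congr1 lastc).
    rewrite lastcZ el mulr1 => dE; move: d0; rewrite -dE /lastc !mxE ltxx.
    by [].
  have Yl := cone_boundary_lor_int_gt0 Yb Ys0 eK.
  have yy := cone_boundary_lor Yb.
  (* Pairing [BY s] with the null vector [Y s] leaves [- s * lor (Y s) (A *m Y s) <= 0] on one side
     and a positive number on the other. *)
  have := cpA _ yy.
  have := congr1 (lor (Y s)) (BY s).
  rewrite /B mulmxBl mul_scalar_mx -scalemxAl lorDr lorNr !lorZr yy.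
  have := mulr_gt0 d0 Yl; case/andP: s01 => s0 _ h1 h2 h3.
  have := mulr_ge0 s0 h3; lra.
exists (Y 1); split=> //; have := BY 1.
rewrite {1}/B subrr scale1r (_ : 0%:M = 0) ?sub0r ?mulNmx; last first.
  by rewrite -scalemx1 scale0r.
move=> ->; apply: icone_intZ => //.
by rewrite lt_def sqr_ge0 sqrf_eq0 detA ?lexx ?ler01.
Qed.

End ConeBoundary.

(** * Maximising a Rayleigh quotient *)

Section FormMaximum.
Context {R : realType} {n : nat}.
Implicit Types (M N P : 'M[R]_n) (u : 'rV[R]_n) (x : 'cV[R]_n).

(** Row vectors are used here to fit [EVT_max_rV]. *)
Lemma continuous_quad M :
  continuous (fun u => dotv u^T (M *m u^T)).
Proof.
have -> : (fun u => dotv u^T (M *m u^T)) =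
    (fun u => \sum_i u 0 i * \sum_j M i j * u 0 j).
  apply/funext => v; rewrite dotvE; apply: eq_bigr => i _; rewrite !mxE.
  by congr (_ * _); apply: eq_bigr => j _; rewrite mxE.
move=> u; apply: (@cvg_sumr _ _ _ (nbhs u)) => i.
apply: (@cvgM _ _ (nbhs u)); first exact: coord_continuous.
apply: (@cvg_sumr _ _ _ (nbhs u)) => j.
by apply: (@cvgMl_tmp _ _ (nbhs u)); exact: coord_continuous.
Qed.

Lemma psd_kernel N x : N^T = N -> (forall y, 0 <= dotv y (N *m y)) ->
  dotv x (N *m x) = 0 -> N *m x = 0.
Proof.
move=> Nsym Npsd xNx; apply/eqP; apply: contraT => Nx0.
pose g := N *m x; have G0 := dotv_gt0 Nx0; rewrite -/g in G0.
pose K := dotv g (N *m g); have K0 : 0 <= K := Npsd g.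
(* With [G = dotv g g], the form takes the value [- (K + 2) * G ^+ 2 < 0] at this vector. *)
have := Npsd ((K + 1) *: x - dotv g g *: g).
rewrite mulmxBr -!scalemxAr -/g dotvDr dotvNr !dotvZr !dotvDl !dotvNl !dotvZl.
rewrite {1}/g xNx -/K (dotv_mulmx N x) Nsym -/g.
have := mulr_gt0 G0 G0; set G := dotv g g => GG.
have := mulr_ge0 (ltW GG) K0; nra.
Qed.

(** At a maximiser on the unit sphere the positive semidefinite form [mu P - M] vanishes, so
    [psd_kernel] yields the eigenvector equation. A vector [y] witnessing that [M] is not negative
    definite gives [mu >= 0]. *)
Lemma not_negdef_eigen M P : M^T = M -> posdefmx P -> ~ negdefmx M ->
  exists mu x, [/\ 0 <= mu, x != 0 & M *m x = mu *: (P *m x)].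
Proof.
move=> Msym [Psym Ppos] Mneg.
have {}Ppos x : x != 0 -> 0 < dotv x (P *m x).
  by move=> x0; rewrite -quad_dotv Ppos.
have {Psym}Psym : P^T = P by apply/eqP; rewrite -symmetricmxE.
have [y y0 yMy] : exists2 y, y != 0 & 0 <= dotv y (M *m y).
  apply: contrapT => noy; apply: Mneg; split.
    by rewrite symmetricmxE linearN/= Msym.
  move=> x x0; rewrite quad_dotv mulNmx dotvNr oppr_gt0 ltNge; apply/negP => xMx.
  by apply: noy; exists x.
pose S := [set u : 'rV[R]_n | dotv u^T u^T = 1].
pose f u := dotv u^T (M *m u^T) / dotv u^T (P *m u^T).
have nS x : x != 0 -> S ((norm2 x)^-1 *: x^T).
  move=> x0; rewrite /S/= linearZ/= trmxK dotvZl dotvZr -norm2_sqr.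
  by field; rewrite norm2_eq0.
have S0 u : S u -> u^T != 0.
  move=> uS; apply/eqP => u0; move: uS; rewrite /S/= u0 /dotv mulmx0 mxE.
  by move/eqP; rewrite eq_sym oner_eq0.
have cS : compact S.
  apply: bounded_closed_compact.
    exists 1; split; first exact: num_real.
    move=> c c1 u uS /=; rewrite [leLHS]mx_normrE; apply: bigmax_le.
      by rewrite ltW// (lt_trans ltr01).
    move=> [i j] _ /=; rewrite ord1; apply: le_trans (ltW c1).
    have := norm_entry_le_norm2 u^T j; rewrite mxE => /le_trans; apply.
    by rewrite norm2E uS sqrtr1.
  have cq : continuous (fun u : 'rV[R]_n => dotv u^T u^T : R).
    by have := @continuous_quad 1%:M; under eq_fun do rewrite mul1mx.
  have := continuous_closedP (fun u : 'rV[R]_n => dotv u^T u^T); case=> + _.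
  by move=> /(_ cq [set r : R | r = 1] (@closed_eq R 1)).
have [||u uS umax] := @EVT_max_rV R n f S _ cS.
- by exists ((norm2 y)^-1 *: y^T); exact: nS.
- apply: continuous_in_subspaceT => u /set_mem uS.
  apply: (@cvgM _ _ (nbhs u)); first exact: (@continuous_quad M u).
  apply: (@cvgV _ _ (nbhs u)); last exact: (@continuous_quad P u).
  by rewrite gt_eqF// Ppos// S0.
have {}uS : S u by exact: set_mem.
pose mu := f u.
have le_mu x : x != 0 -> dotv x (M *m x) <= mu * dotv x (P *m x).
  move=> x0; rewrite -ler_pdivrMr ?Ppos//.
  have := umax _ (mem_set (nS x x0)); rewrite /f linearZ/= trmxK.
  rewrite -!scalemxAr !dotvZl !dotvZr !mulrA -mulf_div divff ?mul1r//.
  by rewrite mulf_neq0// invr_eq0 norm2_eq0.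
have u0 := S0 _ uS.
exists mu, u^T; split=> //.
  by have := le_trans yMy (le_mu y y0); rewrite pmulr_lge0// Ppos.
have := @psd_kernel (mu *: P - M) u^T; rewrite linearB/= linearZ/= Psym Msym.
rewrite mulmxBl -scalemxAl => /(_ erefl) H; apply/eqP; rewrite eq_sym -subr_eq0.
apply/eqP; apply: H.
  move=> x; rewrite mulmxBl -scalemxAl dotvDr dotvNr dotvZr subr_ge0.
  by have [->|/le_mu//] := eqVneq x 0; rewrite /dotv !mulmx0 !mxE mulr0.
by rewrite dotvDr dotvNr dotvZr /mu /f divfK ?subrr// gt_eqF// Ppos.
Qed.

End FormMaximum.

(** For [s > 0], a kernel vector would make [(1 - s) / s >= 0] an eigenvalue of [A]. *)
Lemma hurwitz_homotopy_det (R : realType) (n : nat) (A : 'M[R]_n) :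
  hurwitz A -> forall s, 0 <= s <= 1 -> \det ((1 - s)%:M - s *: A) != 0.
Proof.
move=> hA s /andP[s0 s1].
have [->|sn0] := eqVneq s 0; first by rewrite subr0 scale0r subr0 det1 oner_eq0.
apply/det0P => -[v v0]; rewrite mulmxBr mul_mx_scalar -scalemxAr => /eqP.
rewrite subr_eq0 eq_sym => /eqP vA.
have : eigenvalue A ((1 - s) / s).
  apply/eigenvalueP; exists v => //.
  by rewrite mulrC -scalerA -vA scalerA mulVf// scale1r.
rewrite -(eigenvalue_map (real_complex R)) => /hA /=.
by rewrite ltNge divr_ge0// subr_ge0.
Qed.

(** * The matrix exponential to first order *)

HB.instance Definition _ (R : realType) (p q : nat) :=
  Uniform_isComplete.Build 'M[R]_(p, q) (@mx_complete R p q).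

Section MatrixExponential.
Context {R : realType}.

Lemma norm_entry_le p q (M : 'M[R]_(p, q)) i j : `|M i j| <= `|M|.
Proof.
rewrite [leRHS]mx_normrE.
by apply/bigmax_geP; right; exists (i, j).
Qed.

(** The norm is the largest absolute entry, and each entry of the product is a sum of [q] terms. *)
Lemma norm_mulmx_le p q r (M : 'M[R]_(p, q)) (N : 'M[R]_(q, r)) :
  `|M *m N| <= q%:R * `|M| * `|N|.
Proof.
rewrite [leLHS]mx_normrE; apply: bigmax_le => [|[i j] _ /=].
  by rewrite !mulr_ge0.
rewrite mxE; apply: le_trans (ler_norm_sum _ _ _) _.
apply: (@le_trans _ _ (\sum_(k < q) `|M| * `|N|)); last first.
  by rewrite sumr_const card_ord -mulrA mulr_natl.
by apply: ler_sum => k _; rewrite normrM ler_pM// norm_entry_le.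
Qed.

Lemma norm2_le_norm n (x : 'cV[R]_n) : norm2 x <= n%:R * `|x|.
Proof.
rewrite -(@ler_pXn2r _ 2) ?nnegrE ?norm2_ge0 ?mulr_ge0//.
rewrite norm2_sqr dotvE exprMn.
apply: (@le_trans _ _ (\sum_(k < n) `|x| ^+ 2)).
  apply: ler_sum => k _; rewrite -expr2 -real_normK ?num_real//.
  by rewrite lerXn2r ?nnegrE// norm_entry_le.
rewrite sumr_const card_ord -[leLHS]mulr_natl ler_wpM2r ?exprn_ge0//.
by case: n x => [|n] x; rewrite ?expr0n// expr2 ler_peMr// ler1n.
Qed.

Lemma norm_exprmx_le n (A : 'M[R]_n) k : `|A ^+ k| <= (n%:R * `|A|) ^+ k.
Proof.
elim: k => [|k IH].
  rewrite !expr0 [leLHS]mx_normrE; apply: bigmax_le => // -[i j] _ /=.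
  by rewrite mxE; case: (i == j); rewrite ?normr1 ?normr0.
rewrite !exprS; apply: le_trans (norm_mulmx_le _ _) _.
by rewrite ler_wpM2l// mulr_ge0.
Qed.

Lemma exprmxZ n (A : 'M[R]_n) (t : R) k : (t *: A) ^+ k = t ^+ k *: A ^+ k.
Proof.
elim: k => [|k IH]; first by rewrite !expr0 scale1r.
by rewrite !exprS IH -[LHS]/((t *: A) *m (t ^+ k *: A ^+ k)) -scalemxAl -scalemxAr scalerA.
Qed.

Lemma series_recl2 (V : zmodType) (u : nat -> V) N :
  series u N.+2 = u 0%N + (u 1%N + \sum_(2 <= k < N.+2) u k).
Proof. by rewrite /series/= big_ltn// big_ltn. Qed.

(** For [0 <= t <= 1] and [k >= 2], the [k]-th term is at most [t^2 c^k / k!]; summing gives the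
    constant [C = exp c]. *)
Lemma expmx_first_order n (A : 'M[R]_n) : exists2 C : R, 0 <= C &
  forall t, 0 <= t <= 1 -> `|expmx (t *: A) - (1%:M + t *: A)| <= C * t ^+ 2.
Proof.
pose c := n%:R * `|A|; have c0 : 0 <= c by rewrite mulr_ge0.
exists (expR c); first exact: expR_ge0.
move=> t /andP[t0 t1].
pose u k := (k`!%:R)^-1 *: (t *: A) ^+ k.
have ule k : `|u k| <= t ^+ k * exp_coeff c k.
  rewrite /u exprmxZ scalerA normrZ normrM normfV normr_nat.
  rewrite (ger0_norm (exprn_ge0 _ t0)) mulrAC mulrC ler_wpM2l ?exprn_ge0//.
  by rewrite /exp_coeff/= mulrC ler_wpM2r ?invr_ge0// norm_exprmx_le.
(* Absolute convergence suffices, matrices having been declared complete above. *)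
have cvgu : series u @ \oo --> expmx (t *: A).
  apply: normed_cvg; apply: (series_le_cvg _ _ _ (is_cvg_series_exp_coeff c)).
  - by move=> k; exact: normr_ge0.
  - by move=> k; exact: exp_coeff_ge0.
  - move=> k; apply: le_trans (ule k) _.
    by rewrite ler_piMl ?exp_coeff_ge0// exprn_ile1.
pose B := 1%:M + t *: A.
have bound N : `|series u N.+2 - B| <= expR c * t ^+ 2.
  rewrite series_recl2.
  have -> : u 0%N = 1%:M by rewrite /u fact0 invr1 scale1r expr0.
  have -> : u 1%N = t *: A by rewrite /u invr1 scale1r expr1.
  rewrite addrA -/B [_ - B]addrC addKr; apply: le_trans (ler_norm_sum _ _ _) _.
  apply: (@le_trans _ _ (\sum_(2 <= k < N.+2) exp_coeff c k * t ^+ 2)).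
    rewrite !big_seq; apply: ler_sum => k; rewrite mem_index_iota => /andP[k2 _].
    apply: le_trans (ule k) _; rewrite mulrC ler_wpM2l ?exp_coeff_ge0//.
    by apply: ler_wiXn2l.
  rewrite -mulr_suml ler_wpM2r ?exprn_ge0//.
  apply: (@le_trans _ _ (series (exp_coeff c) N.+2)).
    by rewrite series_recl2 addrA lerDr addr_ge0// exp_coeff_ge0.
  apply: nondecreasing_cvgn_le; last exact: is_cvg_series_exp_coeff.
  by apply: nondecreasing_series => k _ _; exact: exp_coeff_ge0.
have cvgn : `|series u N - B| @[N --> \oo] --> `|expmx (t *: A) - B|.
  by apply: cvg_norm; apply: cvgB => //; exact: cvg_cst.
rewrite -(cvg_lim _ cvgn)//; apply: limr_le; first exact: cvgP cvgn.
by exists 2%N; [by []|move=> N /= N2; rewrite -(subnKC N2) add2n].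
Qed.

End MatrixExponential.

(** * From invariance under the flow to cross-positivity *)

Section CrossPositivity.
Context {R : realType} {m : nat}.
Implicit Types (x y : 'cV[R]_(m + 1)) (A : 'M[R]_(m + 1)).

(** Cauchy-Schwarz, [J] being a Euclidean isometry. *)
Lemma lor_norm2_le x y : `|lor x y| <= norm2 x * norm2 y.
Proof.
apply: le_trans (cauchy_schwarz _ _) _; rewrite le_eqVlt; apply/orP; left.
apply/eqP; congr (_ * _); rewrite !norm2E dotv_mulmx tr_minkowski.
by rewrite mulmxA minkowskiK mul1mx.
Qed.

Lemma icecreamE x : icecream x <-> 0 <= lastc x /\ 0 <= lor x x.
Proof.
rewrite /icecream/= lor_sqr subr_ge0 norm2_sqr dotvE /lastc.
under eq_bigr do rewrite expr2.
by split=> -[].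
Qed.

(* Along the flow of a boundary point the Lorentz form, which starts at 0,
   stays nonnegative, so that its derivative at 0 is nonnegative. *)
Lemma flow_invariant_cross_positive A :
  flow_invariant (@icecream R m) A -> cross_positive A.
Proof.
move=> inv x xx.
(* Both conditions are quadratic in [x], hence unchanged under [x -> - x]. *)
wlog xl : x xx / 0 <= lastc x => [H|].
  have [xl|xl] := leP 0 (lastc x); first exact: H.
  have := H (- x); rewrite mulmxN !lorNl !lorNr !opprK lastcN oppr_ge0.
  by move=> /(_ xx (ltW xl)).
have xK : icecream x by apply/icecreamE; rewrite xx.
have [C C0 expC] := expmx_first_order A.
pose K := (m + 1)%:R * ((m + 1)%:R * C * `|x|).
have K0 : 0 <= K by rewrite !mulr_ge0.
pose X := norm2 x; pose Y := norm2 (A *m x).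
have [X0 Y0] : 0 <= X /\ 0 <= Y by rewrite !norm2_ge0.
set L := lor x (A *m x).
(* [Z] bounds all terms of order two and higher: for [0 < t <= 1], the form at [exp (t A) x] is at
   most [t * (2 * L + t * Z)]. *)
pose Z := 2 * X * K + 2 * Y * K + Y ^+ 2 + K ^+ 2.
have Z0 : 0 <= Z by rewrite !addr_ge0// ?mulr_ge0// exprn_ge0.
have LZ t : 0 < t -> t <= 1 -> 0 <= 2 * L + t * Z.
  move=> t0 t1; pose r := (expmx (t *: A) - (1%:M + t *: A)) *m x.
  have rK : norm2 r <= K * t ^+ 2.
    rewrite (_ : _ * t ^+ 2 = (m + 1)%:R * ((m + 1)%:R * (C * t ^+ 2) * `|x|));
      last by rewrite /K; ring.
    apply: le_trans (norm2_le_norm _) _; rewrite ler_wpM2l//.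
    apply: le_trans (norm_mulmx_le _ _) _; rewrite ler_wpM2r// ler_wpM2l//.
    by apply: expC; rewrite (ltW t0) t1.
  have rE : expmx (t *: A) *m x = x + t *: (A *m x) + r.
    by rewrite /r mulmxBl mulmxDl mul1mx -scalemxAl addrC subrK.
  have [_] := (icecreamE _).1 (inv x xK t (ltW t0)).
  rewrite rE !(lorDl, lorDr) xx !(lorZl, lorZr) (lorC r x) (lorC (A *m x) x).
  rewrite (lorC r (A *m x)) -/L.
  have xr : lor x r <= X * (K * t ^+ 2).
    apply: le_trans (ler_norm _) _; apply: le_trans (lor_norm2_le _ _) _.
    by rewrite ler_wpM2l.
  have yr : lor (A *m x) r <= Y * (K * t ^+ 2).
    apply: le_trans (ler_norm _) _; apply: le_trans (lor_norm2_le _ _) _.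
    by rewrite ler_wpM2l.
  have rr : lor r r <= (K * t ^+ 2) * (K * t ^+ 2).
    apply: le_trans (ler_norm _) _; apply: le_trans (lor_norm2_le _ _) _.
    by rewrite ler_pM// norm2_ge0.
  have yy : lor (A *m x) (A *m x) <= Y ^+ 2.
    by apply: le_trans (ler_norm _) _; rewrite expr2 lor_norm2_le.
  have t2 : 0 <= t ^+ 2 by rewrite sqr_ge0.
  have tyr := ler_wpM2l (ltW t0) yr.
  have tyy := ler_wpM2l t2 yy.
  have yk : 0 <= (Y * K) * (t ^+ 2 * (1 - t)) 
    by rewrite mulr_ge0 ?(mulr_ge0 Y0 K0)// mulr_ge0// subr_ge0.
  have kk : 0 <= K ^+ 2 * (t ^+ 2 * (1 - t ^+ 2)).
    rewrite mulr_ge0 ?sqr_ge0// mulr_ge0// subr_ge0.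
    by rewrite exprn_ile1// ltW.
  move: xr tyr rr tyy yk kk; rewrite -(pmulr_rge0 (2 * L + t * Z) t0) /Z.
  move: (lor x r) (lor (A *m x) r) (lor r r) (lor (A *m x) (A *m x)) => p q p' q'.
  by move=> *; lra.
rewrite leNgt; apply/negP => L0.
have d0 : 0 < Z + 1 - L by lra.
(* If [L < 0], this [t] lies in []0, 1]] and is small enough for [2 * L + t * Z] to stay
   negative. *)
pose t := - L / (Z + 1 - L).
have t0 : 0 < t by rewrite divr_gt0 ?oppr_gt0.
have t1 : t <= 1 by rewrite ler_pdivrMr//; lra.
have := LZ t t0 t1.
have -> : 2 * L + t * Z = L * ((Z + 2 * (1 - L)) / (Z + 1 - L)).
  by rewrite /t; field; rewrite gt_eqF.
by rewrite nmulr_rge0// leNgt divr_gt0//; lra.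
Qed.

End CrossPositivity.

(** * Construction of the Lyapunov matrix *)

Theorem corollary2 (R : realType) (m : nat) (A : 'M[R]_(m + 1)) :
  flow_invariant (@icecream R m) A ->
  hurwitz A ->
  exists P : 'M[R]_(m + 1),
    lyapunov A P /\
    (P = 1%:M \/
     exists b : 'cV[R]_m, b != 0 /\
       let bbar : 'cV[R]_m := (norm2 b)^-1 *: b in
       P = 1%:M
           + (coshR (norm2 b) - 1) *:
               block_mx (bbar *m bbar^T) 0 0 (1%:M : 'M[R]_1)
           + sinhR (norm2 b) *:
               block_mx (0 : 'M[R]_m) bbar bbar^T (0 : 'M[R]_1)).
Proof.
move=> /flow_invariant_cross_positive cpA /hurwitz_homotopy_det detA.
have cpAt := cross_positive_tr cpA.
have normalized (B : 'M[R]_(m + 1)) :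
    (exists v, icone_int v /\ icone_int (- (B *m v))) ->
    exists v, [/\ icone_int v, icone_int (- (B *m v)) & lor v v = 1].
  move=> [v [vK BvK]]; have [_ vv] := (icone_intP v).1 vK.
  pose k := (Num.sqrt (lor v v))^-1.
  have k0 : 0 < k by rewrite invr_gt0 sqrtr_gt0.
  exists (k *: v); split; first exact: icone_intZ.
    by rewrite -scalemxAr -scalerN; apply: icone_intZ.
  rewrite lorZl lorZr mulrA -expr2 exprVn sqr_sqrtr ?(ltW vv)//.
  by rewrite mulVf// gt_eqF.
have [v [vK AvK v1]] := normalized _ (cross_positive_int_vector cpA detA).
have [s s01|w [wK AwK w1]] := normalized _ (cross_positive_int_vector cpAt _).
  by rewrite -det_tr linearB/= linearZ/= trmxK tr_scalar_mx detA.
have [a [aK a1 Pv]] := boost_transitive vK wK v1 w1.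
set P := boost a in Pv.
exists P; split; last by apply: boostE => //; exact: icone_int_lastc_gt0.
have Ppos : posdefmx P := boost_posdef a1.
split=> //.
have PT : P^T = P := tr_boost a.
have Msym : (P *m A + A^T *m P)^T = P *m A + A^T *m P.
  by rewrite linearD/= !trmx_mul trmxK PT addrC.
apply: contrapT => /(not_negdef_eigen Msym Ppos)[mu [x [mu0 /eqP x0 Mx]]].
apply: x0.
have PJP (y : 'cV[R]_(m + 1)) : P *m (J *m (P *m y)) = J *m y := boostK y a1.
have JK (y : 'cV[R]_(m + 1)) : J *m (J *m y) = y by rewrite mulmxA minkowskiK mul1mx.
have Pinv (y : 'cV[R]_(m + 1)) : J *m (P *m (J *m (P *m y))) = y.
  by rewrite PJP JK.
(* As [J P J] is the inverse of [P], this is [A + P^-1 A^T P]. *)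
pose A' := A + J *m P *m J *m A^T *m P.
have A'E (y : 'cV[R]_(m + 1)) : A' *m y = A *m y + J *m (P *m (J *m (A^T *m (P *m y)))).
  by rewrite mulmxDl -!mulmxA.
apply: (@cross_positive_no_eigen _ _ A' v x mu) => //.
- move=> y yy; rewrite A'E lorDr addr_ge0 ?cpA//.
  (* Moving [P] to the left argument turns the second summand into cross-positivity of [A^T] at
     [P y], again a null vector. *)
  rewrite lor_minkowski -[X in dotv _ X]/(P *m _) dotv_mulmx PT -/(lor _ _).
  by apply: cpAt; rewrite lor_boost.
(* Since [P v = w], the second summand is [J P J] applied to [- A^T w], and both [J] and [P]
   preserve the interior. *)
- rewrite A'E Pv opprD; apply: icone_intD => //; rewrite -3!mulmxN.
  by apply: icone_int_minkowski; apply: icone_int_boost => //;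
    apply: icone_int_minkowski.
- have PA' : P *m (A' *m x) = mu *: (P *m x).
    by rewrite A'E mulmxDr PJP JK -Mx mulmxDl !mulmxA.
  by rewrite -[LHS]Pinv PA' -!scalemxAr Pinv.
Qed.
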